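(* Let $n\ge 3$ and let $X$ be an optimal function over the cycle $C_n$. Then there exists a vertex $x_0\in V(C_n)$ such that $|X(v)-X(x_0)|=d(x_0,v)$ for all $v\in V(C_n)$.
   Context: For a finite connected graph $G$ with graph distance $d$, a function $X:V(G)\to\mathbb{R}$ is Lipschitz if $|X(u)-X(v)|\le d(u,v)$ for all $u,v$; it is treated as a random variable by placing the uniform distribution on $V(G)$. The subgaussian constant $\sigma_X^2$ is the smallest value $\sigma^2$ such that $\mathbb{E}\, e^{t(X-\mathbb{E}X)}\le e^{\sigma^2t^2/2}$ for all real $t$. $\sigma_G$ is the supremum of $\sigma_X$ over all Lipschitz functions $X$ on $G$. A Lipschitz function $X$ on $G$ is optimal if $\sigma_X=\sigma_G$. *)

(* Defs.v *)
From HB Require Import structures.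
From mathcomp Require Import all_boot all_order all_algebra.
From mathcomp Require Import classical_sets reals.
From mathcomp Require Import sequences.

Set Implicit Arguments.
Unset Strict Implicit.
Unset Printing Implicit Defensive.

Import Order.TTheory GRing.Theory Num.Theory.

Local Open Scope ring_scope.
Local Open Scope classical_set_scope.

(* A graph is given by its adjacency relation on a finite type of vertices. *)

(* Length of a shortest path from u to v.  The search may stop below #|T|
   because a duplicate-free path has fewer than #|T| edges; when v is not
   reachable from u the value is #|T|. *)
Definition gdist (T : finType) (e : rel T) (u v : T) : nat :=
  find (fun k => [exists p : k.-tuple T, path e u p && (last u p == v)])
       (iota 0 #|T|).

Lemma gdist_le (T : finType) (e : rel T) (u : T) (p : seq T) :
  path e u p -> (gdist e u (last u p) <= size p)%N.
Proof.
move=> ep; rewrite /gdist; set a := (fun k : nat => _).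
have ap : a (size p) by apply/existsP; exists (in_tuple p); rewrite ep eqxx.
have [sp|sp] := ltnP (size p) #|T|; last first.
  by apply: leq_trans sp; rewrite -[leqRHS](size_iota 0) find_size.
rewrite leqNgt; apply/negP => /(before_find 0%N).
by rewrite nth_iota // add0n ap.
Qed.

Lemma gdist_path (T : finType) (e : rel T) (u v : T) : connect e u v ->
  exists p : seq T, [/\ path e u p, last u p = v & size p = gdist e u v].
Proof.
move=> /connectP[p0 ep0 ->]; case/shortenP: ep0 => p ep up _.
rewrite /gdist; set a := (fun k : nat => _).
have sp : (size p < #|T|)%N by have := card_uniqP up => /= <-; exact: max_card.
have /(nth_find 0%N) : has a (iota 0 #|T|).
  apply/hasP; exists (size p); first by rewrite mem_iota.
  by apply/existsP; exists (in_tuple p); rewrite ep eqxx.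
rewrite nth_iota ?add0n; last first.
  apply: leq_ltn_trans sp; exact: gdist_le.
by move=> /existsP[q /andP[eq /eqP lq]]; exists q; rewrite size_tuple.
Qed.

Definition cycle_graph (n : nat) : rel 'I_n :=
  [rel i j | (j == ordS i) || (i == ordS j)].

Lemma cycle_graph_sym (n : nat) : symmetric (@cycle_graph n).
Proof. by move=> i j; rewrite /cycle_graph /= orbC. Qed.

Lemma cycle_graph_irrefl (n : nat) : (1 < n)%N -> irreflexive (@cycle_graph n).
Proof.
move=> n1 i; rewrite /cycle_graph /= orbb; apply/negbTE/eqP => /(congr1 val)/= /eqP.
have [lt|ge] := ltnP i.+1 n; first by rewrite modn_small // ltn_eqF.
have -> : i.+1 = n by apply/eqP; rewrite eqn_leq ge ltn_ord.
by rewrite modnn => /eqP i0; move: ge; rewrite i0 leqNgt n1.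
Qed.

Lemma cycle_graph_connected (n : nat) (i j : 'I_n) :
  connect (@cycle_graph n) i j.
Proof.
have H0 (k : nat) (a b : 'I_n) : val b = (a + k)%N ->
    connect (@cycle_graph n) a b.
  elim: k a b => [|k IH] a b; first by rewrite addn0 => /val_inj ->.
  move=> bE; have an : (a.+1 < n)%N.
    by apply: leq_ltn_trans (ltn_ord b); rewrite bE addnS ltnS leq_addr.
  apply: (@connect_trans _ _ (Ordinal an)).
    by apply: connect1; apply/orP; left; apply/eqP/val_inj; rewrite /= modn_small.
  by apply: IH; rewrite bE addnS.
have [le|/ltnW le] := leqP i j; first by apply: (H0 (j - i)%N); rewrite subnKC.
rewrite sym_connect_sym; last exact: cycle_graph_sym.
by apply: (H0 (i - j)%N); rewrite subnKC.
Qed.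

Section Subgaussian.
Variable R : realType.

Definition graph_lipschitz (T : finType) (e : rel T) (X : T -> R) : Prop :=
  forall u v, `|X u - X v| <= (gdist e u v)%:R.

(* Expectation under the uniform distribution on T. *)
Definition expect (T : finType) (X : T -> R) : R :=
  (\sum_v X v) / #|T|%:R.

(* sigma_X^2.  On a nonempty T the set is nonempty (Hoeffding's lemma), consists
   of nonnegative reals (Jensen) and is closed, so the infimum is a minimum. *)
Definition subgaussian_const (T : finType) (X : T -> R) : R :=
  inf [set s : R | forall t : R,
    expect (fun v => expR (t * (X v - expect X))) <= expR (s * t ^+ 2 / 2)].

Definition sigma (T : finType) (X : T -> R) : R :=
  Num.sqrt (subgaussian_const X).

(* The supremum is over a nonempty set bounded by half the diameter. *)
Definition sigma_graph (T : finType) (e : rel T) : R :=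
  sup [set sigma X | X in [set X : T -> R | graph_lipschitz e X]].

Definition optimal (T : finType) (e : rel T) (X : T -> R) : Prop :=
  graph_lipschitz e X /\ sigma X = sigma_graph e.

End Subgaussian.

(* Main.v *)
Require Import Defs.
From HB Require Import structures.
From mathcomp Require Import all_boot all_order all_algebra.
From mathcomp Require Import boolp classical_sets reals.
From mathcomp Require Import topology normedtype sequences derive exp.
From mathcomp Require Import zify ring lra.

Set Implicit Arguments.
Unset Strict Implicit.
Unset Printing Implicit Defensive.

Import Order.TTheory GRing.Theory Num.Theory.
Import numFieldNormedType.Exports.

Local Open Scope ring_scope.

(* Let s = sigma_X^2 for an optimal X, so that E exp(t(Y - EY)) <= exp(s t^2/2)
   for all t and all Lipschitz Y.  If equality holds for X at some t <> 0, then
   X maximises E exp(t(Y - EY)) over Lipschitz Y; otherwise, by compactness and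
   Taylor's formula at t = 0, Var X = s, so X maximises the variance.  In both
   cases X maximises E psi(Y - EY) for some strictly convex psi.

   Deleting a vertex leaves C_n connected, so the increasing rearrangement
   x_0 <= x_1 <= ... of X satisfies x_{i+2} <= x_i + 1, which says that it is
   Lipschitz when laid out along the Hamiltonian cycle 0, 2, 4, ..., 5, 3, 1;
   hence x maximises the energy among such sequences.  The gradient c_i =
   psi'(x_i - mean) minus its mean is increasing, say <= 0 up to p and >= 0 after.
   The sequence with gaps g, 1-g, g, 1-g, ... through x_p and x_{p+1} lies below x
   to the left and above x to the right, so by strict convexity it equals x.
   Convexity in g forces g = 0 or 1, so the values of |X - X(x0)| for an extremal
   vertex x0 are 0, 1, 1, 2, 2, ...; their sum is at least that of the distances to
   x0, and the Lipschitz bound |X(v) - X(x0)| <= d(x0, v) is everywhere sharp. *)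

(** * Increasing sequences with two-step gaps at most 1 *)

Section SortedProfiles.
Variable R : realFieldType.
Implicit Types (x y c : nat -> R) (g b : R).

(** Strict convexity with a chosen subgradient, so that no derivative of [psi] has to be taken. *)
Definition strict_subgradient (psi dpsi : R -> R) : Prop :=
  forall u v, u != v -> psi u + dpsi u * (v - u) < psi v.

Lemma strict_subgradient_le (psi dpsi : R -> R) u v :
  strict_subgradient psi dpsi -> u <= v -> dpsi u <= dpsi v.
Proof.
move=> H; rewrite le_eqVlt => /orP[/eqP->//|uv].
have := H u v; have := H v u; rewrite (lt_eqF uv) (gt_eqF uv) => /(_ isT) h1 /(_ isT) h2.
have : 0 < (dpsi v - dpsi u) * (v - u) by lra.
by rewrite pmulr_lgt0 ?subr_gt0// => /ltW.
Qed.

(* Functions on [0, n) that are Lipschitz for the cycle 0, 2, 4, ..., 5, 3, 1;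
   the increasing rearrangement of a Lipschitz function on C_n is one. *)
Definition profile (n : nat) (x : nat -> R) : Prop :=
  (forall i, (i.+1 < n)%N -> x i <= x i.+1) /\
  (forall i, (i.+2 < n)%N -> x i.+2 <= x i + 1).

Definition seq_mean (n : nat) (x : nat -> R) : R := (\sum_(i < n) x i) / n%:R.

Definition seq_energy (n : nat) (psi : R -> R) (x : nat -> R) : R :=
  \sum_(i < n) psi (x i - seq_mean n x).

Lemma profile_mono n x i j : profile n x -> (i <= j)%N -> (j < n)%N -> x i <= x j.
Proof.
move=> [mx _]; elim: j => [|j IH]; first by case: i.
rewrite leq_eqVlt => /orP[/eqP->//|ij] jn.
by apply: le_trans (IH _ _) (mx _ _) => //; lia.
Qed.

Lemma profile_succ n x i : (2 < n)%N -> profile n x -> (i.+1 < n)%N ->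
  x i.+1 <= x i + 1.
Proof.
move=> n2 [mx mx2] ir; have [ir2|ir2] := ltnP i.+2 n.
  by apply: le_trans (mx2 _ ir2); exact: mx.
(* At the last gap the two-step bound is used from the preceding index, which exists because
   [2 < n]. *)
case: i ir ir2 => [|i] ir ir2; first lia.
by apply: le_trans (mx2 _ ir) _; rewrite lerD2r; apply: mx; lia.
Qed.

Lemma sum_sub_seq_mean n x : (0 < n)%N -> \sum_(i < n) (x i - seq_mean n x) = 0.
Proof.
move=> n0; rewrite sumrB sumr_const card_ord -mulr_natr /seq_mean.
by rewrite divfK ?subrr// pnatr_eq0; lia.
Qed.

(** The subgradient inequalities are summed at the centred values. Centring leaves the linear term
    unchanged, because both the centred [c] and the differences [d] sum to zero. Strictness comes
    from the index where the centred values differ. *)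
Lemma seq_energy_lt n psi dpsi x y (c := fun i => dpsi (x i - seq_mean n x)) :
  strict_subgradient psi dpsi -> (0 < n)%N ->
  0 <= \sum_(i < n) (c i - seq_mean n c) * (y i - x i) ->
  (exists2 i, (i < n)%N & y i - x i != seq_mean n y - seq_mean n x) ->
  seq_energy n psi x < seq_energy n psi y.
Proof.
move=> H n0 c0 [k kn kP].
set d := fun i => (y i - seq_mean n y) - (x i - seq_mean n x).
have dE : \sum_(i < n) c i * d i = \sum_(i < n) (c i - seq_mean n c) * (y i - x i).
  have dsum : \sum_(i < n) d i = 0 by rewrite sumrB !sum_sub_seq_mean// subrr.
  have csum : \sum_(i < n) (c i - seq_mean n c) = 0 by rewrite sum_sub_seq_mean.
  transitivity (\sum_(i < n) ((c i - seq_mean n c) * (y i - x i)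
      - (seq_mean n y - seq_mean n x) * (c i - seq_mean n c) + seq_mean n c * d i)).
    by apply: eq_bigr => i _; rewrite /d; ring.
  by rewrite big_split sumrB /= -!mulr_sumr csum dsum !mulr0 subr0 addr0.
apply: (@le_lt_trans _ _ (\sum_(i < n) (psi (x i - seq_mean n x) + c i * d i))).
  by rewrite big_split /= dE lerDl.
have le i : psi (x i - seq_mean n x) + c i * d i <= psi (y i - seq_mean n y).
  have [E|ne] := eqVneq (x i - seq_mean n x) (y i - seq_mean n y).
    by rewrite /d E subrr mulr0 addr0.
  exact/ltW/H.
rewrite /seq_energy (bigD1 (Ordinal kn)) //= [ltRHS](bigD1 (Ordinal kn)) //=.
apply: ltr_leD; last by apply: ler_sum => i _.
apply: H; apply: contraNneq kP => E; apply/eqP; lra.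
Qed.

Definition maximal_profile (n : nat) (psi : R -> R) (x : nat -> R) : Prop :=
  profile n x /\ forall y, profile n y -> seq_energy n psi y <= seq_energy n psi x.

(** At a maximiser, a direction of nonnegative slope can only be a translation: any other would
    strictly raise the energy. *)
Lemma maximal_profile_shift n psi dpsi x y (c := fun i => dpsi (x i - seq_mean n x)) :
  strict_subgradient psi dpsi -> maximal_profile n psi x -> profile n y ->
  0 <= \sum_(i < n) (c i - seq_mean n c) * (y i - x i) ->
  forall i j, (i < n)%N -> (j < n)%N -> y i - x i = y j - x j.
Proof.
move=> H [_ mx] py c0 i j ir jr.
suff E k : (k < n)%N -> y k - x k = seq_mean n y - seq_mean n x by rewrite !E.
move=> kn; apply/eqP/negPn/negP => kP.
have := seq_energy_lt H (leq_ltn_trans (leq0n _) kn) c0 (ex_intro2 _ _ k kn kP).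
by rewrite ltNge mx.
Qed.

(* The profile with gaps g, 1 - g, g, 1 - g, ... *)
Definition alt g b (i : nat) : R := b + i./2%:R + (odd i)%:R * g.

Lemma alt2 g b i : alt g b i.+2 = alt g b i + 1.
Proof. by rewrite /alt /= negbK -natr1; ring. Qed.

Lemma profile_alt g b n : 0 <= g <= 1 -> profile n (alt g b).
Proof.
move=> /andP[g0 g1]; split=> i _; last by rewrite alt2.
rewrite /alt /= uphalf_half natrD; case: (odd i) => /=; lra.
Qed.

Lemma altP p u v : u <= v <= u + 1 ->
  exists g b, [/\ 0 <= g <= 1, alt g b p = u & alt g b p.+1 = v].
Proof.
move=> /andP[uv vu].
(* The gap of [alt g b] after index [p] is [g] for even [p] and [1 - g] for odd [p]. *)
exists (if odd p then 1 - (v - u) else v - u).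
exists (u - p./2%:R - (odd p)%:R * (1 - (v - u))).
rewrite /alt /= uphalf_half natrD; case: (odd p) => /=.
  by split; [apply/andP; split; lra| lra | lra].
by split; [apply/andP; split; lra| lra | lra].
Qed.

(** The two sequences agree at [p] and [p.+1]. Over two steps [alt] gains exactly 1 and [x] at most
    1, so walking left by twos preserves the inequality. *)
Lemma alt_below n x g b p i : profile n x -> (p.+1 < n)%N ->
  alt g b p = x p -> alt g b p.+1 = x p.+1 -> (i <= p)%N -> alt g b i <= x i.
Proof.
move=> [_ x2] pn E1 E2 ip.
suff S k j : (j + k.*2 = p \/ j + k.*2 = p.+1)%N -> alt g b j <= x j.
  by apply: (S (p.+1 - i)./2 i); lia.
elim: k j => [|k IH] j; first by rewrite addn0 => -[->|->]; rewrite ?E1 ?E2.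
move=> jk; rewrite -(lerD2r 1) -alt2; apply: le_trans (x2 _ _); last lia.
by apply: IH; lia.
Qed.

Lemma alt_above n x g b p i : profile n x -> (i < n)%N ->
  alt g b p = x p -> alt g b p.+1 = x p.+1 -> (p < i)%N -> x i <= alt g b i.
Proof.
move=> [_ x2] ni E1 E2 pi.
suff S k j : (j < n)%N -> (j = p + k.*2 \/ j = p.+1 + k.*2)%N -> x j <= alt g b j.
  by apply: (S (i - p)./2 i) => //; lia.
elim: k j => [|k IH] j jn; first by rewrite !addn0 => -[->|->]; rewrite ?E1 ?E2.
move=> jk; case: j jn jk => [|[|j]] jn jk; [lia|lia|].
rewrite alt2; apply: le_trans (x2 _ jn) _; rewrite lerD2r.
by apply: IH; lia.
Qed.

(** The pivot is the last index before the final one whose value does not exceed the mean;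
    [p.+1 < n] leaves room for two anchor points. *)
Lemma exists_pivot n c : (1 < n)%N ->
  (forall i j, (i <= j)%N -> (j < n)%N -> c i <= c j) ->
  exists2 p, (p.+1 < n)%N & forall i, (i < n)%N ->
    if (i <= p)%N then c i <= seq_mean n c else seq_mean n c <= c i.
Proof.
move=> n1 mc; have n0 : 0 < n%:R :> R by rewrite ltr0n; lia.
have c0 : c 0%N <= seq_mean n c.
  rewrite ler_pdivlMr// mulr_natr -[X in _ *+ X]card_ord -sumr_const.
  by apply: ler_sum => i _; apply: mc.
have cn : seq_mean n c <= c n.-1.
  rewrite ler_pdivrMr// mulr_natr -[X in _ *+ X]card_ord -sumr_const.
  by apply: ler_sum => -[i ir] _; apply: mc => /=; lia.
pose P i := (i.+1 < n)%N && (c i <= seq_mean n c).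
have eP : exists i, P i by exists 0%N; rewrite /P n1.
have ubP i : P i -> (i <= n)%N by move=> /andP[]; lia.
case: (ex_maxnP eP ubP) => p /andP[pn cp] pmax; exists p => // i ir.
case: leqP => ip; first by apply: le_trans cp; apply: mc => //; lia.
have [E|ne] := eqVneq i n.-1; first by rewrite E.
rewrite leNgt; apply/negP => /ltW lt.
by have := pmax i; rewrite /P lt andbT; lia.
Qed.

Lemma maximal_profile_alt n psi dpsi x : (2 < n)%N ->
  strict_subgradient psi dpsi -> maximal_profile n psi x ->
  exists g b, 0 <= g <= 1 /\ forall i, (i < n)%N -> x i = alt g b i.
Proof.
move=> n2 H mx; have [px _] := mx.
set c := fun i => dpsi (x i - seq_mean n x).
have mc i j : (i <= j)%N -> (j < n)%N -> c i <= c j.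
  move=> ij jn; apply: (strict_subgradient_le H); rewrite lerD2r.
  exact: (profile_mono px).
have [p pn pP] := exists_pivot (ltnW n2) mc.
have [|g [b [g01 E1 E2]]] := @altP p (x p) (x p.+1).
  by rewrite (profile_succ n2 px pn) andbT; have [mx1 _] := px; apply: mx1.
exists g, b; split=> // i ir.
(* Up to the pivot both factors are nonpositive, after it both are nonnegative. *)
have c0 : 0 <= \sum_(i < n) (c i - seq_mean n c) * (alt g b i - x i).
  apply: sumr_ge0 => -[k kn] _ /=; have := pP _ kn; case: leqP => kp ck.
    by apply: mulr_le0; rewrite subr_le0//; apply: (alt_below px pn).
  by apply: mulr_ge0; rewrite subr_ge0//; apply: (alt_above px _ E1 E2).
have := maximal_profile_shift H mx (profile_alt _ _ g01) c0 ir (ltnW pn).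
by rewrite E1 subrr; lra.
Qed.

(** The indices [2k] and [2k+1] carry weights -1/2 and 1/2, so each pair contributes half of an
    increment. *)
Lemma sum_odd_minus_half_ge0 m c :
  (forall k, (k < m)%N -> c k.*2 <= c k.*2.+1) ->
  0 <= \sum_(i < m.*2) c i * ((odd i)%:R - 2^-1).
Proof.
elim: m => [|m IH] H; first by rewrite big_ord0.
rewrite doubleS !big_ord_recr /= odd_double /=.
have := H m (ltnSn m); have := IH (fun k km => H k (ltnW km)); lra.
Qed.

(* The values 0, 1, 1, 2, 2, ... up to sign and translation: those of the
   distance to a vertex of C_n. *)
Lemma maximal_profile_dist n psi dpsi x : (2 < n)%N ->
  strict_subgradient psi dpsi -> maximal_profile n psi x ->
  (forall i, (i < n)%N -> x i = x 0%N + (i.+1)./2%:R) \/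
  (forall i, (i < n)%N -> x i = x n.-1 - (n - i)./2%:R).
Proof.
move=> n2 H mx; have [px _] := mx.
have [g [b [g01 xE]]] := maximal_profile_alt n2 H mx.
set c := fun i => dpsi (x i - seq_mean n x).
have mc i j : (i <= j)%N -> (j < n)%N -> c i <= c j.
  move=> ij jn; apply: (strict_subgradient_le H); rewrite lerD2r.
  exact: (profile_mono px).
(* [K] is the slope of the linearised energy in the gap [g]; its sign tells which endpoint of [0, 1]
   [g] must already occupy. *)
set K := \sum_(i < n) (c i - seq_mean n c) * (odd i)%:R.
have KE h : \sum_(i < n) (c i - seq_mean n c) * (alt h b i - x i) = K * (h - g).
  rewrite mulr_suml; apply: eq_bigr => i _; rewrite xE// /alt; ring.
have shift h : 0 <= h <= 1 -> 0 <= K * (h - g) -> h = g.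
  move=> h01; rewrite -KE => /(maximal_profile_shift H mx (profile_alt _ _ h01)).
  move=> /(_ 0%N 1%N (ltnW (ltnW n2)) (ltnW n2)).
  rewrite !xE ?(ltnW n2)// ?(ltnW (ltnW n2))// /alt /=; lra.
have [K0|K0] := leP 0 K.
  have gE : 1 = g.
    by apply: shift; [rewrite ler01 lexx|apply: mulr_ge0 => //; lra].
  left=> i ir; rewrite (xE i ir) (xE 0%N (ltnW (ltnW n2))) -gE /alt /=.
  by rewrite uphalf_half natrD; ring.
have gE : g = 0.
  by apply/esym/shift; [lra|rewrite sub0r mulrN -mulNr mulr_ge0//; lra].
(* For odd [n], gap 0 gives a single top value with pairs below it. For even [n], pairing the
   indices yields [0 <= K], against the sign of [K]. *)
case odn : (odd n).
  right=> i ir; rewrite !xE ?gE /alt ?mulr0 ?addr0; try lia.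
  rewrite -addrA -natrB; last lia.
  by congr (_ + _%:R); lia.
suff : 0 <= K by rewrite leNgt K0.
have -> : K = \sum_(i < n) (c i - seq_mean n c) * ((odd i)%:R - 2^-1).
  rewrite /K; under [RHS]eq_bigr do rewrite mulrBr.
  by rewrite sumrB -mulr_suml sum_sub_seq_mean ?mul0r ?subr0//; lia.
have nE : n./2.*2 = n by lia.
suff : 0 <= \sum_(i < n./2.*2) (c i - seq_mean n c) * ((odd i)%:R - 2^-1).
  by rewrite nE.
apply: (@sum_odd_minus_half_ge0 _ (fun i => c i - seq_mean n c)) => k kn.
by rewrite lerD2r mc//; lia.
Qed.
End SortedProfiles.

(** * Lipschitz functions on the cycle *)

Lemma graph_lipschitz_edge (R : realType) (T : finType) (e : rel T) (X : T -> R)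
  u v : graph_lipschitz e X -> e u v -> `|X u - X v| <= 1.
Proof.
move=> LX uv; apply: le_trans (LX u v) _; rewrite (ler_nat _ _ 1).
by have := @gdist_le _ e u [:: v]; rewrite /= uv; apply.
Qed.

Lemma edge_graph_lipschitz (R : realType) (T : finType) (e : rel T) (X : T -> R) :
  (forall u v, connect e u v) ->
  (forall u v, e u v -> `|X u - X v| <= 1) -> graph_lipschitz e X.
Proof.
move=> con LX u v; have [p [ep <- <-]] := gdist_path (con u v).
elim: p u ep => [|w p IH] u /=; first by rewrite subrr normr0.
move=> /andP[uw wp]; rewrite -nat1r.
have -> : X u - X (last w p) = (X u - X w) + (X w - X (last w p)) by ring.
by apply: le_trans (ler_normD _ _) _; apply: lerD; [exact: LX|exact: IH].
Qed.

(** * Distances and the zigzag order on the cycle *)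

Section Cycle.
Variable n : nat.
Implicit Types u v w : 'I_n.

Lemma iter_ordS k v : (iter k (@ordS n) v = (v + k) %% n :> nat)%N.
Proof.
elim: k => [|k /= ->]; first by rewrite addn0 modn_small.
by rewrite -addn1 modnDml addn1 addnS.
Qed.

Lemma iter_ordS_inj v (k l : 'I_n) :
  iter k (@ordS n) v = iter l (@ordS n) v -> k = l.
Proof.
move=> /(congr1 val); rewrite /= !iter_ordS => /eqP.
by rewrite eqn_modDl !modn_small// => /eqP/val_inj.
Qed.

Lemma iter_ordS_n v : iter n (@ordS n) v = v.
Proof. by apply: val_inj; rewrite /= iter_ordS modnDr modn_small. Qed.

Lemma gdist_iter_ordS v k :
  (gdist (@cycle_graph n) v (iter k (@ordS n) v) <= k)%N.
Proof.
rewrite -last_traject -[leqRHS](size_traject (@ordS n) (ordS v) k).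
apply: gdist_le; apply: sub_path (fpath_traject _ _ _) => a b /= /eqP <-.
by rewrite /cycle_graph /= eqxx.
Qed.

Lemma gdist_iter_ordS_rev v k : (k <= n)%N ->
  (gdist (@cycle_graph n) v (iter k (@ordS n) v) <= n - k)%N.
Proof.
move=> kn; set w := iter k _ _.
have -> : w = iter (n - k) (@ord_pred n) v.
  have <- : iter (n - k) (@ordS n) w = v by rewrite -iterD subnK// iter_ordS_n.
  by elim: (n - k)%N => //= l IH; rewrite -iterS iterSr ordSK.
rewrite -last_traject -[leqRHS](size_traject (@ord_pred n) (ord_pred v) (n - k)).
apply: gdist_le; apply: sub_path (fpath_traject _ _ _) => a b /= /eqP <-.
by rewrite /cycle_graph /= ord_predK eqxx orbT.
Qed.

(* Position of the k-th vertex in the Hamiltonian cycle 0, 2, 4, ..., 5, 3, 1. *)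
Definition zigzag (k : nat) : nat :=
  if (k.*2 < n)%N then k.*2 else (n - k).*2.-1.

Lemma zigzagE k :
  (k.*2 < n /\ zigzag k = k.*2 \/ n <= k.*2 /\ zigzag k = (n - k).*2.-1)%N.
Proof. by rewrite /zigzag; case: (ltnP k.*2 n); [left|right]. Qed.

Lemma zigzag_lt (k : 'I_n) : (zigzag k < n)%N.
Proof. by have := zigzagE k; have := ltn_ord k; lia. Qed.

Definition zigzag_ord (k : 'I_n) : 'I_n := Ordinal (zigzag_lt k).

Lemma zigzag_ord_inj : injective zigzag_ord.
Proof.
move=> k l /(congr1 val) /= E; apply: val_inj => /=; move: E.
by have := zigzagE k; have := zigzagE l; have := ltn_ord k; have := ltn_ord l; lia.
Qed.

Lemma zigzag_edge u v : cycle_graph u v ->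
  (zigzag u <= zigzag v + 2)%N /\ (zigzag v <= zigzag u + 2)%N.
Proof.
wlog : u v / v = ordS u.
  move=> H /orP[/eqP E|/eqP E]; first by apply: H => //; rewrite E /cycle_graph /= eqxx.
  by apply/and_comm/H => //; rewrite E /cycle_graph /= eqxx.
move=> /(congr1 val) /= vE _; have := zigzagE u; have := zigzagE v; move: vE.
have un := ltn_ord u; have [lt|ge] := ltnP u.+1 n.
  by rewrite modn_small// => ->; lia.
(* The closing edge, from [n - 1] back to [0]. *)
have -> : u.+1 = n by lia.
by rewrite modnn => ->; lia.
Qed.

(** The vertex [k] steps after [v] is at distance at most min(k, n - k), which is exactly
    [(zigzag k).+1./2]; since [zigzag] permutes the positions, the bounds add up to the right-hand
    side. *)
Lemma sum_gdist_le v :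
  (\sum_u gdist (@cycle_graph n) v u <= \sum_(i < n) i.+1./2)%N.
Proof.
have bij : bijective (fun k : 'I_n => iter k (@ordS n) v).
  exact/injF_bij/iter_ordS_inj.
rewrite (reindex _ (onW_bij _ bij)) /=.
rewrite [leqRHS](reindex _ (onW_bij _ (injF_bij zigzag_ord_inj))) /=.
apply: leq_sum => k _; have kn := ltn_ord k.
have := gdist_iter_ordS v k; have := gdist_iter_ordS_rev v (ltnW kn).
by have := zigzagE k; lia.
Qed.

End Cycle.

(** * Rearrangement of Lipschitz functions on the cycle *)

Section LipschitzOnCycle.
Variables (R : realType) (n : nat).
Implicit Types X : 'I_n -> R.

(** The left-hand sum bounds the total distance from [x0], so no single Lipschitz bound at [x0] can
    be slack. *)
Lemma cycle_distance_function X x0 :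
  graph_lipschitz (@cycle_graph n) X ->
  \sum_(i < n) (i.+1)./2%:R <= \sum_v `|X v - X x0| ->
  forall v, `|X v - X x0| = (gdist (@cycle_graph n) x0 v)%:R.
Proof.
move=> LX le v.
have LX' u : `|X u - X x0| <= (gdist (@cycle_graph n) x0 u)%:R by rewrite distrC.
apply/eqP; rewrite eq_le LX' leNgt; apply/negP => lt.
suff : \sum_u `|X u - X x0| < \sum_(i < n) (i.+1)./2%:R by rewrite ltNge le.
apply: (@lt_le_trans _ _ (\sum_u (gdist (@cycle_graph n) x0 u)%:R)); last first.
  by rewrite -!natr_sum ler_nat sum_gdist_le.
rewrite (bigD1 v) //= [ltRHS](bigD1 v) //=.
by apply: ltr_leD => //; apply: ler_sum.
Qed.

(** Turns profiles into competitors on the cycle: adjacent vertices occupy positions at most two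
    apart. *)
Lemma zigzag_lipschitz (y : nat -> R) : (2 < n)%N -> profile n y ->
  graph_lipschitz (@cycle_graph n) (y \o @zigzag n).
Proof.
move=> n2 py; apply: edge_graph_lipschitz => [u v|u v uv] /=.
  exact: cycle_graph_connected.
have := zigzag_edge uv; have := zigzag_lt u; have := zigzag_lt v.
move: (zigzag n u) (zigzag n v) => i j.
wlog ij : i j / (i <= j)%N.
  move=> H jn ir [h1 h2]; have [le|/ltnW le] := leqP i j; first exact: H.
  by rewrite distrC; apply: H.
move=> jn _ [_ h]; have [_ y2] := py.
rewrite distrC ger0_norm ?subr_ge0 ?(profile_mono py)// lerBlDl.
have [E|[E|E]] : j = i \/ j = i.+1 \/ j = i.+2 by lia.
- by rewrite E lerDl ler01.
- by rewrite E; apply: (profile_succ n2 py); rewrite -E.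
- by rewrite E; apply: y2; rewrite -E.
Qed.

(* Deleting the vertex w leaves C_n connected, and no edge joins the two sides. *)
Lemma cycle_split X w a : graph_lipschitz (@cycle_graph n) X ->
  (forall v, v != w -> X v <= a \/ a + 1 < X v) ->
  (forall v, v != w -> X v <= a) \/ (forall v, v != w -> a + 1 < X v).
Proof.
move=> LX H.
have n0 : (0 < n)%N by apply: leq_ltn_trans (ltn_ord w).
have neq k : (0 < k < n)%N -> iter k (@ordS n) w != w.
  move=> /andP[k0 kn]; apply/eqP => /(@iter_ordS_inj _ w (Ordinal kn) (Ordinal n0)).
  by move=> /(congr1 val) /= E; rewrite E in k0.
(* An edge changes [X] by at most 1 and so cannot jump from one side of the gap to the other. *)
have step k : (0 < k)%N -> (k.+1 < n)%N ->
    (X (iter k (@ordS n) w) <= a) = (X (iter k.+1 (@ordS n) w) <= a).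
  move=> k0 kn; have := H _ (neq k _); have := H _ (neq k.+1 kn).
  have := @graph_lipschitz_edge _ _ _ _ (iter k (@ordS n) w) (iter k.+1 (@ordS n) w) LX.
  rewrite /cycle_graph /= eqxx => /(_ isT); rewrite ler_norml => /andP[h1 h2].
  rewrite k0 (ltnW kn) => h3 /(_ isT) h4.
  by apply/idP/idP => h; [case: h3|case: h4] => //; lra.
have all k : (0 < k < n)%N -> (X (iter k (@ordS n) w) <= a) = (X (ordS w) <= a).
  move=> /andP[k0 kn]; elim: k k0 kn => // -[//|k] IH _ kn.
  by rewrite -step// IH// ltnW.
have ex v : v != w -> exists2 k, (0 < k < n)%N & v = iter k (@ordS n) w.
  have [g _ fK] := injF_bij (@iter_ordS_inj n w).
  move=> vw; exists (g v) => //; rewrite ltn_ord andbT lt0n.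
  by apply: contraNneq vw => g0; rewrite -(fK v) g0.
case E : (X (ordS w) <= a); [left|right] => v vw; have [k kn vE] := ex v vw.
  by rewrite vE all.
by case: (H v vw) => //; rewrite vE all// E.
Qed.

(** If the value of rank [i.+2] exceeded that of rank [i] by more than 1, deleting the vertex of
    rank [i.+1] would leave values on both sides of a gap, which [cycle_split] forbids. *)
Lemma sorted_profile X (v0 : 'I_n) : graph_lipschitz (@cycle_graph n) X ->
  exists2 s : seq 'I_n, perm_eq s (enum 'I_n) & profile n (fun i => X (nth v0 s i)).
Proof.
move=> LX; pose r : rel 'I_n := fun u v => X u <= X v.
exists (sort r (enum 'I_n)); first exact/permPl/perm_sort.
set s := sort _ _.
have ss : size s = n by rewrite size_sort size_enum_ord.
have us : uniq s by rewrite sort_uniq enum_uniq.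
have mono i j : (i <= j)%N -> (j < n)%N -> X (nth v0 s i) <= X (nth v0 s j).
  have rtr : transitive r by move=> a b c; apply: le_trans.
  have rre : reflexive r by move=> a; apply: lexx.
  have rto : total r by move=> a b; apply: le_total.
  move=> ij jn; apply: (sorted_leq_nth rtr rre v0 (sort_sorted rto _)) => //.
    by rewrite inE -/s ss; apply: leq_ltn_trans ij jn.
  by rewrite inE -/s ss.
split=> i ir; first exact: mono.
rewrite leNgt; apply/negP => lt.
have ir0 : (i < n)%N by lia.
have ir1 : (i.+1 < n)%N by lia.
have neq j : (j < n)%N -> j != i.+1 -> nth v0 s j != nth v0 s i.+1.
  by move=> jn; apply: contra; rewrite nth_uniq ?ss.
have := @cycle_split X (nth v0 s i.+1) (X (nth v0 s i)) LX.
case=> [v vw|H|H].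
- have vs : v \in s by rewrite mem_sort mem_enum.
  have jn : (index v s < n)%N by rewrite -[ltnRHS]ss index_mem.
  rewrite -(nth_index v0 vs) in vw *.
  have [le|gt] := leqP (index v s) i; first by left; apply: mono.
  right; apply: lt_le_trans lt _; apply: mono => //.
  rewrite ltn_neqAle gt andbT.
  by apply: contraNneq vw => ->.
- have := H _ (neq _ ir _); rewrite eqn_leq ltnn /= => /(_ isT); lra.
- have := H _ (neq _ ir0 _); rewrite eqn_leq ltnn andbF => /(_ isT); lra.
Qed.

Definition centered_energy (psi : R -> R) X : R := \sum_v psi (X v - expect X).

Lemma energy_maximizer_distance psi dpsi X : (2 < n)%N ->
  strict_subgradient psi dpsi -> graph_lipschitz (@cycle_graph n) X ->
  (forall Y, graph_lipschitz (@cycle_graph n) Y ->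
     centered_energy psi Y <= centered_energy psi X) ->
  exists x0 : 'I_n, forall v, `|X v - X x0| = (gdist (@cycle_graph n) x0 v)%:R.
Proof.
move=> n2 H LX mX; have n0 : (0 < n)%N by lia.
pose v0 := Ordinal n0; have [s sP px] := sorted_profile v0 LX.
set x := fun i => _ in px.
have sumE (F : 'I_n -> R) : \sum_v F v = \sum_(i < n) F (nth v0 s i).
  transitivity (\sum_(v <- enum 'I_n) F v).
    by rewrite (@big_enum _ _ _ _ (mem 'I_n)).
  rewrite -(perm_big _ sP) (big_nth v0) big_mkord.
  by rewrite (perm_size sP) size_enum_ord.
have EX psi' : centered_energy psi' X = seq_energy n psi' x.
  by rewrite /centered_energy /seq_energy sumE /expect sumE card_ord.
have EY y : centered_energy psi (y \o @zigzag n) = seq_energy n psi y.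
  have zE F : \sum_(v : 'I_n) F (zigzag n v) = \sum_(i < n) F i :> R.
    by rewrite [RHS](reindex _ (onW_bij _ (injF_bij (@zigzag_ord_inj n)))).
  rewrite /centered_energy /seq_energy /expect /seq_mean card_ord /= zE.
  exact: (zE (fun i => psi (y i - _))).
(* Sorting and the zigzag layout both permute values, hence preserve the energy. *)
have mx : maximal_profile n psi x.
  by split=> // y py; rewrite -EX -EY; apply/mX/zigzag_lipschitz.
have [xE|xE] := maximal_profile_dist n2 H mx.
  exists (nth v0 s 0); apply: cycle_distance_function => //.
  rewrite [leRHS]sumE; apply: ler_sum => i _; have := xE _ (ltn_ord i); rewrite /x => ->.
  by rewrite addrAC subrr add0r normr_nat.
exists (nth v0 s n.-1); apply: cycle_distance_function => //.
(* Counting ranks from the top turns [(n - i)./2] into [i.+1./2]. *)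
rewrite [leRHS]sumE [leRHS](reindex_inj rev_ord_inj) /=.
apply: ler_sum => i _; have := xE _ (ltn_ord (rev_ord i)); rewrite /x => ->.
rewrite addrAC subrr add0r normrN normr_nat ler_nat.
by rewrite /= subKn.
Qed.

End LipschitzOnCycle.

(** * Moment generating functions and the subgaussian constant *)

Section ExpBounds.
Variable R : realType.
Implicit Types z : R.

(** Since exp(-z) >= 1 - z, the product (1 - z) exp(z) is at most 1, while (1 - z)(1 + z + 2z^2) = 1
    + z^2 (1 - 2z). *)
Lemma expR_le_quad z : z <= 1 / 2 -> expR z <= 1 + z + 2 * z ^+ 2.
Proof.
move=> z2; have z1 : 0 < 1 - z by lra.
rewrite -(ler_pM2r z1); apply: (@le_trans _ _ 1).
  by rewrite -[leRHS](expRxMexpNx_1 z) ler_pM2l ?expR_gt0// expR_ge1Dx.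
have : 0 <= z ^+ 2 * (1 - 2 * z) by apply: mulr_ge0; [exact: sqr_ge0|lra].
lra.
Qed.

(** For a centred variable the linear term averages to zero, which yields a crude subgaussian
    bound. *)
Lemma expR_le_sqr z : expR z <= z + expR (2 * z ^+ 2).
Proof.
have [z2|z2] := leP z (1 / 2).
  apply: le_trans (expR_le_quad z2) _.
  by rewrite addrAC addrC lerD2l expR_ge1Dx.
apply: (@le_trans _ _ (expR (2 * z ^+ 2))); last by rewrite lerDr; lra.
rewrite ler_expR -subr_ge0.
have -> : 2 * z ^+ 2 - z = z * (2 * z - 1) by ring.
by apply: mulr_ge0; lra.
Qed.

Lemma is_derive_ge0_le (f df : R -> R) a b :
  (forall x : R, is_derive x (1 : R) f (df x)) -> a <= b ->
  (forall x, a <= x <= b -> 0 <= df x) -> f a <= f b.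
Proof.
move=> fd ab df0.
have [|c + E] := MVT_segment ab (fun x _ => fd x).
  apply: continuous_subspaceT => x.
  exact/differentiable_continuous/derivable1_diffP.
rewrite in_itv /= => cab.
by rewrite -subr_ge0 E mulr_ge0 ?df0// subr_ge0.
Qed.

Lemma expR_taylor2 z : `|z| <= 1 / 2 ->
  `|expR z - (1 + z + z ^+ 2 / 2)| <= `|z| ^+ 3.
Proof.
move=> z2.
pose f x : R := expR x - (1 + x + x ^+ 2 / 2).
(* The coefficient 2/3 makes the derivative of [g] the slack in [expR_le_quad]. *)
pose g x : R := (1 + x + x ^+ 2 / 2 + x ^+ 3 * (2 / 3)) - expR x.
have df (x : R) : is_derive x (1:R) f (expR x - (1 + x)).
  by rewrite /f; apply: is_derive_eq; rewrite /GRing.scale /=; field.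
have dg (x : R) : is_derive x (1:R) g (1 + x + 2 * x ^+ 2 - expR x).
  by rewrite /g; apply: is_derive_eq; rewrite /GRing.scale /=; field.
have f0 : f 0 = 0 by rewrite /f expR0; ring.
have g0 : g 0 = 0 by rewrite /g expR0; ring.
have df0 (x : R) : 0 <= expR x - (1 + x) by rewrite subr_ge0 expR_ge1Dx.
have dg0 (x : R) : x <= 1 / 2 -> 0 <= 1 + x + 2 * x ^+ 2 - expR x.
  by move=> x2; rewrite subr_ge0; exact: expR_le_quad.
move: z2; have [z0|/ltW z0] := ger0P z => z2.
  have fz : f 0 <= f z by apply: (is_derive_ge0_le df).
  have gz : g 0 <= g z.
    by apply: (is_derive_ge0_le dg) => // x /andP[_ xz]; apply: dg0; lra.
  have z3 : 0 <= z ^+ 3 by apply: exprn_ge0.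
  rewrite f0 g0 /f /g in fz gz.
  by rewrite ger0_norm; lra.
have fz : f z <= f 0 by apply: (is_derive_ge0_le df).
have gz : g z <= g 0.
  by apply: (is_derive_ge0_le dg) => // x /andP[_ xz]; apply: dg0; lra.
have z3 : 0 <= (- z) ^+ 3 by apply: exprn_ge0; lra.
rewrite f0 g0 /f /g in fz gz.
by rewrite ler0_norm; lra.
Qed.

Lemma strict_subgradient_expR (t : R) : t != 0 ->
  strict_subgradient (fun u => expR (t * u)) (fun u => t * expR (t * u)).
Proof.
move=> t0 u v uv.
have -> : t * v = t * u + t * (v - u) by ring.
have -> : expR (t * u) + t * expR (t * u) * (v - u) =
  expR (t * u) * (1 + t * (v - u)) by ring.
rewrite expRD ltr_pM2l ?expR_gt0//; apply: expR_gt1Dx.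
by rewrite mulf_neq0// subr_eq0 eq_sym.
Qed.

Lemma strict_subgradient_sqr :
  strict_subgradient (fun u : R => u ^+ 2) (fun u => 2 * u).
Proof.
move=> u v uv; have : 0 < (v - u) ^+ 2 by rewrite exprn_even_gt0//= subr_eq0 eq_sym.
lra.
Qed.

End ExpBounds.

(** * Subgaussian bounds and variance on a finite uniform space *)

Section Mgf.
Variables (R : realType) (T : finType).
Hypothesis T0 : (0 < #|T|)%N.
Implicit Types (f g X Y : T -> R) (s t M : R).

Lemma ler_expect f g : (forall v, f v <= g v) -> expect f <= expect g.
Proof.
by move=> fg; rewrite ler_pM2r ?invr_gt0 ?ltr0n//; apply: ler_sum => v _.
Qed.

Lemma eq_expect f g : f =1 g -> expect f = expect g.
Proof. by move=> fg; rewrite /expect (eq_bigr _ (fun v _ => fg v)). Qed.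

Lemma expect_affine f a b : expect (fun v => a + b * f v) = a + b * expect f.
Proof.
rewrite /expect big_split /= -mulr_sumr sumr_const -[a *+ _]mulr_natr mulrDl.
rewrite mulfK ?mulrA//.
by rewrite pnatr_eq0 -lt0n.
Qed.

Lemma expectD f g : expect (fun v => f v + g v) = expect f + expect g.
Proof. by rewrite /expect big_split mulrDl. Qed.

Lemma expect_cst (a : R) : expect (fun _ : T => a) = a.
Proof.
by have := expect_affine (fun=> 0) a 0; rewrite !mul0r addr0.
Qed.

Lemma expect_centered X : expect (fun v => X v - expect X) = 0.
Proof.
have := expect_affine X (- expect X) 1; rewrite mul1r addNr => <-.
by apply: eq_expect => v; rewrite mul1r addrC.
Qed.

Lemma ler_norm_expect f M : (forall v, `|f v| <= M) -> `|expect f| <= M.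
Proof.
move=> fM; rewrite ler_norml -{1}(expect_cst (- M)) -{2}(expect_cst M).
apply/andP; split; apply: ler_expect => v; have := fM v; rewrite ler_norml;
by case/andP.
Qed.

Definition mgf X t : R := expect (fun v => expR (t * (X v - expect X))).

Definition variance X : R := expect (fun v => (X v - expect X) ^+ 2).

Lemma variance_ge0 X : 0 <= variance X.
Proof. by rewrite -[leLHS](expect_cst 0); apply: ler_expect => v; apply: sqr_ge0. Qed.

Lemma mgf_ge1 X t : 1 <= mgf X t.
Proof.
have <- : expect (fun v => 1 + t * (X v - expect X)) = 1.
  by rewrite expect_affine expect_centered mulr0 addr0.
by apply: ler_expect => v; apply: expR_ge1Dx.
Qed.

Lemma mgf0 X : mgf X 0 = 1.
Proof.
by rewrite -[RHS]expect_cst; apply: eq_expect => v; rewrite mul0r expR0.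
Qed.

Definition subgaussian_at X s : Prop := forall t, mgf X t <= expR (s * t ^+ 2 / 2).

Lemma subgaussian_at_ge0 X s : subgaussian_at X s -> 0 <= s.
Proof.
move=> /(_ 1); rewrite expr1n mulr1 => /(le_trans (mgf_ge1 X 1)).
by rewrite leNgt expR_lt1 -leNgt; lra.
Qed.

Lemma subgaussian_at_bounded X M : (forall v, `|X v - expect X| <= M) ->
  subgaussian_at X (4 * M ^+ 2).
Proof.
move=> XM t.
apply: (@le_trans _ _ (expect (fun v =>
    expR (4 * M ^+ 2 * t ^+ 2 / 2) + t * (X v - expect X)))).
  apply: ler_expect => v; apply: le_trans (expR_le_sqr _) _.
  rewrite addrC lerD2r ler_expR exprMn.
  have : (X v - expect X) ^+ 2 <= M ^+ 2.
    by rewrite -real_normK ?num_real// lerXn2r ?nnegrE// (le_trans _ (XM v)).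
  have := sqr_ge0 t; nra.
by rewrite expect_affine expect_centered mulr0 addr0.
Qed.

Lemma subgaussian_const_le X s : subgaussian_at X s -> subgaussian_const X <= s.
Proof.
move=> Xs; apply: ge_inf => //; exists 0 => u; exact: subgaussian_at_ge0.
Qed.

(** The infimum is attained: for each [t != 0] the condition on the constant is the closed half-line
    above 2 ln(mgf X t) / t^2. *)
Lemma subgaussian_const_at X s : subgaussian_at X s ->
  subgaussian_at X (subgaussian_const X).
Proof.
move=> Xs t; have [->|t0] := eqVneq t 0.
  by rewrite mgf0 expr0n /= mulr0 mul0r expR0.
have t2 : 0 < t ^+ 2 / 2 by rewrite divr_gt0// exprn_even_gt0.
have m0 : 0 < mgf X t by apply: lt_le_trans (mgf_ge1 X t).
rewrite -[leLHS]lnK ?posrE// ler_expR -mulrA -ler_pdivrMr//.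
apply: lb_le_inf; first by exists s.
by move=> u /= /(_ t) h; rewrite ler_pdivrMr// -ler_expR lnK// mulrA.
Qed.

Lemma expectB f g : expect (fun v => f v - g v) = expect f - expect g.
Proof. by rewrite /expect sumrB mulrBl. Qed.

Lemma mgf_taylor2 X M t : (forall v, `|X v - expect X| <= M) ->
  `|t| * M <= 1 / 2 ->
  `|mgf X t - (1 + variance X / 2 * t ^+ 2)| <= (`|t| * M) ^+ 3.
Proof.
move=> XM tM.
have <- : expect (fun v => (1 + t * (X v - expect X)) +
    (0 + t ^+ 2 / 2 * (X v - expect X) ^+ 2)) = 1 + variance X / 2 * t ^+ 2.
  rewrite expectD !expect_affine// expect_centered// -/(variance X); ring.
rewrite -expectB; apply: ler_norm_expect => // v.
set z := X v - expect X.
have tz : `|t * z| <= `|t| * M by rewrite normrM ler_wpM2l ?normr_ge0 ?XM.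
have := expR_taylor2 (le_trans tz tM).
have -> : 1 + t * z + (t * z) ^+ 2 / 2 = 1 + t * z + (0 + t ^+ 2 / 2 * z ^+ 2) by field.
move=> h; apply: le_trans h _.
by rewrite lerXn2r ?nnegrE// (le_trans _ tz).
Qed.

(* For small t, 1 + V t^2 / 2 - O(t^3) <= exp (s t^2 / 2) <= 1 + s t^2 / 2 + O(t^4). *)
Lemma variance_le_subgaussian X s M : (forall v, `|X v - expect X| <= M) ->
  subgaussian_at X s -> variance X <= s.
Proof.
move=> XM Xs; have s0 := subgaussian_at_ge0 Xs.
have M0 : 0 <= M.
  by have [v _] := card_gt0P T0; apply: le_trans (XM v).
rewrite leNgt; apply/negP => sV; set V := variance X in sV.
pose e := Num.min (1 / 2) ((V - s) / 4).
have e0 : 0 < e by rewrite lt_min; apply/andP; split; lra.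
have [e2 eV] : e <= 1 / 2 /\ e <= (V - s) / 4.
  by rewrite !ge_min !lexx orbT.
have M30 : 0 <= M ^+ 3 by rewrite exprn_ge0.
have s20 := sqr_ge0 s.
(* [D] dominates all coefficients of the error terms, so with [t = e / D] each of their products
   with [t] is at most [e]. *)
pose D := 1 + M + s + M ^+ 3 + s ^+ 2.
have D0 : 0 < D by rewrite /D; lra.
pose t := e / D; have t0 : 0 < t by rewrite divr_gt0.
have bound a : 0 <= a -> a <= D -> t * a <= e.
  move=> a0 aD; rewrite /t -mulrA ler_piMr//; first exact: ltW.
  by rewrite mulrC ler_pdivrMr// mul1r.
have t1 : t <= e by rewrite -[leLHS]mulr1 bound// /D; lra.
have tM : t * M <= e by apply: bound => //; rewrite /D; lra.
have ts : t * s <= e by apply: bound => //; rewrite /D; lra.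
have tMs : t * (M ^+ 3 + s ^+ 2) <= e by apply: bound; rewrite /D; lra.
have := @mgf_taylor2 X M t XM; rewrite (gtr0_norm t0) => /(_ (le_trans tM e2)).
rewrite ler_norml -/V => /andP[lo _].
have tst : s * t ^+ 2 / 2 <= 1 / 2.
  have : (t * s) * t <= 1 / 2 * 1 by apply: ler_pM; try lra; rewrite mulr_ge0// ltW.
  lra.
have hi := le_trans (Xs t) (expR_le_quad tst).
have t20 : 0 < t ^+ 2 by rewrite exprn_gt0.
have key : t ^+ 2 * (V - s) <= t ^+ 2 * (2 * (t * M ^+ 3) + s ^+ 2 * t ^+ 2).
  by move: lo; rewrite exprMn; lra.
move: key; rewrite ler_pM2l//.
have : s ^+ 2 * t ^+ 2 <= s ^+ 2 * t.
  by apply: ler_wpM2l => //; rewrite -[leRHS]mulr1 expr2 ler_pM2l//; lra.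
have : 0 <= s ^+ 2 * t by rewrite mulr_ge0// ltW.
lra.
Qed.

Lemma mgf_opp X t : mgf (fun v => - X v) t = mgf X (- t).
Proof.
have E : expect (fun v => - X v) = - expect X.
  by rewrite /expect sumrN mulNr.
by apply: eq_expect => v; rewrite E; congr expR; ring.
Qed.

Lemma continuous_mgf X : continuous (mgf X).
Proof.
move=> t; rewrite /mgf /expect; apply: cvgM; last exact: cvg_cst.
apply: cvg_big => [|v _]; first exact: add_continuous.
apply: continuous_comp; last exact: continuous_expR.
by apply: cvgM; [exact: cvg_id|exact: cvg_cst].
Qed.

(* By compactness [m t / exp (s t^2 / 2)] has a maximum below 1 on [a, b]. *)
Lemma strict_subgaussian_segment (m : R -> R) s a b : 0 < a -> a <= b ->
  continuous m -> (forall t, 0 < m t) ->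
  (forall t, a <= t <= b -> m t < expR (s * t ^+ 2 / 2)) ->
  exists2 s', s' < s & forall t, a <= t <= b -> m t <= expR (s' * t ^+ 2 / 2).
Proof.
move=> a0 ab cm m0 ms.
pose h t : R := m t * expR (- (s * t ^+ 2 / 2)).
have ch : continuous h.
  move=> t; apply: cvgM; first exact: cm.
  apply: continuous_comp; last exact: continuous_expR.
  apply: cvgN; apply: cvgM; last exact: cvg_cst.
  by apply: cvgM; [exact: cvg_cst|apply: cvgM; exact: cvg_id].
have [c] := EVT_max ab (continuous_subspaceT ch).
rewrite in_itv /= => cab hmax.
have hc0 : 0 < h c by rewrite mulr_gt0 ?expR_gt0.
have hc1 : h c < 1.
  by rewrite -(expRxMexpNx_1 (s * c ^+ 2 / 2)) ltr_pM2r ?expR_gt0// ms.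
have [eta eta0 hcE] : exists2 eta, 0 < eta & h c = expR (- eta).
  by exists (- ln (h c)); rewrite ?opprK ?lnK ?posrE// oppr_gt0 ln_lt0// hc0.
have b0 : 0 < b by apply: lt_le_trans ab.
have b20 : 0 < b ^+ 2 by rewrite exprn_gt0.
(* As [t <= b], this decrease multiplies the bound by at least exp(-eta), the maximum of [h]. *)
exists (s - 2 * eta / b ^+ 2).
  by rewrite ltrBlDr ltrDl divr_gt0// mulr_gt0.
move=> t /andP[at_ tb].
have : h t <= expR (- eta) by rewrite -hcE hmax// in_itv/= at_ tb.
rewrite /h -ler_pdivlMr ?expR_gt0// -expRN opprK -expRD => /le_trans; apply.
rewrite ler_expR.
have : 2 * eta / b ^+ 2 * t ^+ 2 <= 2 * eta.
  rewrite mulrAC ler_pdivrMr// ler_wpM2l//; first lra.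
  by rewrite lerXn2r// nnegrE; lra.
by move: (2 * eta / b ^+ 2) => q; lra.
Qed.

(* Near 0 the bound with constant s' > variance follows from Taylor's formula,
   for large t from boundedness of X, in between by compactness. *)
Lemma subgaussian_lt X s M : (forall v, `|X v - expect X| <= M) ->
  variance X < s -> (forall t, t != 0 -> mgf X t < expR (s * t ^+ 2 / 2)) ->
  exists2 s', s' < s & subgaussian_at X s'.
Proof.
move=> XM Vs Xs.
have M0 : 0 <= M.
  by have [v _] := card_gt0P T0; apply: le_trans (XM v).
have V0 := variance_ge0 X; set V := variance X in Vs V0.
pose s1 := (V + s) / 2.
have s10 : 0 < s1 by rewrite /s1; lra.
have M30 : 0 <= M ^+ 3 by rewrite exprn_ge0.
pose e := Num.min (1 / 2) ((s1 - V) / 2).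
have e0 : 0 < e by rewrite lt_min /s1; apply/andP; split; lra.
have [e2 eV] : e <= 1 / 2 /\ e <= (s1 - V) / 2.
  by rewrite !ge_min !lexx orbT.
pose a := e / (1 + M + M ^+ 3).
have D0 : 0 < 1 + M + M ^+ 3 by lra.
have a0 : 0 < a by rewrite divr_gt0.
have near0 t : `|t| <= a -> mgf X t <= expR (s1 * t ^+ 2 / 2).
  rewrite /a ler_pdivlMr// => te.
  have t0 : 0 <= `|t| by [].
  have tM0 : 0 <= `|t| * M by rewrite mulr_ge0.
  have tM30 : 0 <= `|t| * M ^+ 3 by rewrite mulr_ge0.
  have := @mgf_taylor2 X M t XM.
  have tM : `|t| * M <= 1 / 2 by lra.
  move=> /(_ tM); rewrite ler_norml -/V => /andP[_ hi].
  apply: le_trans (expR_ge1Dx _).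
  have t2 : `|t| ^+ 2 = t ^+ 2 by rewrite real_normK ?num_real.
  have : t ^+ 2 * (`|t| * M ^+ 3) <= t ^+ 2 * ((s1 - V) / 2).
    by apply: ler_wpM2l; [exact: sqr_ge0|lra].
  by move: hi; rewrite -t2; lra.
(* Beyond [b] one has [|t| * M <= s1 * t ^+ 2 / 2], so the bound holds pointwise before
   averaging. *)
pose b := a + 2 * M / s1.
have ab : a <= b by rewrite lerDl; apply: divr_ge0; [lra|exact: ltW].
have far t : b <= `|t| -> mgf X t <= expR (s1 * t ^+ 2 / 2).
  move=> bt; rewrite -[leRHS]expect_cst; apply: ler_expect => // v.
  rewrite ler_expR; apply: le_trans (ler_norm _) _.
  rewrite normrM; apply: (@le_trans _ _ (`|t| * M)); first exact: ler_wpM2l.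
  have -> : s1 * t ^+ 2 / 2 = `|t| * (`|t| * s1 / 2).
    by rewrite -[t ^+ 2]real_normK ?num_real//; field.
  apply: ler_wpM2l => //.
  suff : 2 * M <= `|t| * s1 by lra.
  by rewrite -ler_pdivrMr//; apply: le_trans bt; rewrite lerDr ltW.
have m0 t : 0 < mgf X t by apply: lt_le_trans (mgf_ge1 X t).
have [|s2 s2s X2] := @strict_subgaussian_segment (mgf X) s a b a0 ab
  (@continuous_mgf X) m0.
  by move=> t /andP[at_ _]; apply: Xs; rewrite gt_eqF// (lt_le_trans a0).
(* Negative [t] are handled through [- X]. *)
have [| |s3 s3s X3] := @strict_subgaussian_segment (mgf (fun v => - X v)) s a b a0 ab
  (@continuous_mgf _).
- by move=> t; rewrite mgf_opp.
- move=> t /andP[at_ _]; rewrite mgf_opp -sqrrN; apply: Xs.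
  by rewrite oppr_eq0 gt_eqF// (lt_le_trans a0).
exists (Num.max s1 (Num.max s2 s3)).
  by rewrite !gt_max s2s s3s !andbT /s1; lra.
have weaken u t : u <= Num.max s1 (Num.max s2 s3) ->
    mgf X t <= expR (u * t ^+ 2 / 2) ->
    mgf X t <= expR (Num.max s1 (Num.max s2 s3) * t ^+ 2 / 2).
  move=> us /le_trans; apply; rewrite ler_expR.
  by apply: ler_wpM2r; [lra|apply: ler_wpM2r => //; exact: sqr_ge0].
move=> t; have [ta|at_] := leP `|t| a.
  by apply: (weaken s1); [rewrite le_max lexx|exact: near0].
have [bt|tb] := leP b `|t|.
  by apply: (weaken s1); [rewrite le_max lexx|exact: far].
have [t0|t0] := leP 0 t.
  rewrite (ger0_norm t0) in at_ tb.
  by apply: (weaken s2); [rewrite !le_max lexx orbT|apply: X2; rewrite !ltW].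
rewrite (ltr0_norm t0) in at_ tb.
apply: (weaken s3); first by rewrite !le_max lexx !orbT.
by have := X3 (- t); rewrite mgf_opp opprK sqrrN; apply; rewrite !ltW.
Qed.

End Mgf.

(** * Optimal functions as energy maximisers *)

Section Optimal.
Variables (R : realType) (T : finType) (e : rel T).
Hypothesis T0 : (0 < #|T|)%N.
Implicit Types X Y : T -> R.

Lemma graph_lipschitz_bounded X : graph_lipschitz e X ->
  forall v, `|X v - expect X| <= #|T|%:R.
Proof.
move=> LX v; rewrite distrC -(expect_cst T0 (X v)) -expectB.
apply: ler_norm_expect => // u; apply: le_trans (LX u v) _.
(* [gdist] never exceeds [#|T|], its default value for unreachable vertices. *)
by rewrite ler_nat -[leqRHS](size_iota 0) find_size.
Qed.

Lemma graph_lipschitz_subgaussian X : graph_lipschitz e X ->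
  subgaussian_at X (subgaussian_const X).
Proof.
move=> /graph_lipschitz_bounded/(subgaussian_at_bounded T0).
exact: subgaussian_const_at.
Qed.

Lemma optimal_subgaussian_const_ge X Y : optimal e X -> graph_lipschitz e Y ->
  subgaussian_const Y <= subgaussian_const X.
Proof.
move=> [LX sX] LY.
have cX := subgaussian_at_ge0 T0 (graph_lipschitz_subgaussian LX).
rewrite -(ler_sqrt _ cX) -/(sigma X) sX -/(sigma Y).
apply: ub_le_sup; last by exists Y.
(* A bound uniform over Lipschitz functions, required for the supremum to be an upper bound. *)
exists (Num.sqrt (4 * #|T|%:R ^+ 2)) => _ [Z /= LZ <-].
rewrite ler_sqrt ?mulr_ge0 ?sqr_ge0//; apply: subgaussian_const_le => //.
exact/(subgaussian_at_bounded T0)/graph_lipschitz_bounded.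
Qed.

Lemma optimal_energy_maximizer X : optimal e X ->
  exists psi dpsi, strict_subgradient psi dpsi /\ forall Y, graph_lipschitz e Y ->
    expect (fun v => psi (Y v - expect Y)) <= expect (fun v => psi (X v - expect X)).
Proof.
move=> oX; have [LX _] := oX; set s := subgaussian_const X.
have Xs := graph_lipschitz_subgaussian LX.
have maxs Y : graph_lipschitz e Y -> subgaussian_at Y s.
  move=> LY t; apply: le_trans (graph_lipschitz_subgaussian LY t) _.
  rewrite ler_expR; apply: ler_wpM2r; first lra.
  by apply: ler_wpM2r; [exact: sqr_ge0|exact: optimal_subgaussian_const_ge].
(* Either [X] touches at some [t != 0] the bound obeyed by every Lipschitz function, or the
   inequality is strict away from 0; then a variance below [s] would allow [s] to be lowered. *)
have [[t t0 tE]|nE] := pselect (exists2 t, t != 0 & expR (s * t ^+ 2 / 2) <= mgf X t).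
  exists (fun u => expR (t * u)), (fun u => t * expR (t * u)).
  split; first exact: strict_subgradient_expR.
  by move=> Y LY; apply: le_trans (maxs Y LY t) tE.
exists (fun u => u ^+ 2), (fun u => 2 * u); split; first exact: strict_subgradient_sqr.
move=> Y LY; apply: (@le_trans _ _ s).
  exact: (variance_le_subgaussian T0 (graph_lipschitz_bounded LY) (maxs Y LY)).
rewrite leNgt; apply/negP => Vs.
have [|s' s's Xs'] := subgaussian_lt T0 (graph_lipschitz_bounded LX) Vs.
  by move=> t t0; rewrite ltNge; apply/negP => tE; apply: nE; exists t.
by have := subgaussian_const_le T0 Xs'; rewrite leNgt s's.
Qed.

End Optimal.

Theorem theorem2p9 (R : realType) (n : nat) (hn : (3 <= n)%N)
  (X : 'I_n -> R) (hX : optimal (@cycle_graph n) X) :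
  exists x0 : 'I_n, forall v : 'I_n,
    `|X v - X x0| = (gdist (@cycle_graph n) x0 v)%:R.
Proof.
have n0 : (0 < #|'I_n|)%N by rewrite card_ord; lia.
have [psi [dpsi [H mX]]] := optimal_energy_maximizer n0 hX.
have [LX _] := hX; apply: (energy_maximizer_distance hn H LX) => Y LY.
by have := mX Y LY; rewrite ler_pM2r// invr_gt0 ltr0n.
Qed.
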